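(* For every $n\ge 2$ there are exactly two globally coherent traversals of $[n]$, namely $\operatorname{MEA}_{n,+}$ and $\operatorname{MEA}_{n,-}$. They are mirror images of each other, i.e. each is obtained from the other by applying $i\mapsto n+1-i$ to every entry.
   Context: Let $[n]=\{1,\ldots,n\}$, $a=\lfloor (n+1)/2\rfloor$, $b=\lceil (n+1)/2\rceil$, $q=\lfloor (n-1)/2\rfloor$. For $r\in\{0,\ldots,q\}$ the bilateral shell of normalized radius $r$ is $B_r=\{a-r,b+r\}$ (a singleton exactly when $n$ is odd and $r=0$); the shells partition $[n]$, and $B_0$ is the central block. A traversal of $[n]$ is a sequence listing each element of $[n]$ exactly once. For $\omega\in\{+,-\}$ the oriented expansion of a shell is $\operatorname{ord}_+(B_r)=(a-r,b+r)$, $\operatorname{ord}_-(B_r)=(b+r,a-r)$, with the duplicate entry removed when $B_0$ is a singleton. A shell traversal is a permutation $(r_0,\ldots,r_q)$ of $\{0,\ldots,q\}$. It satisfies the maximal-radial-contrast rule when $r_0=0$ and for each $1\le k\le q$, $r_k\in\operatorname{arg\,max}_{r\in\{0,\ldots,q\}\setminus\{r_0,\ldots,r_{k-1}\}}|r-r_{k-1}|$. There is exactly one such shell traversal, given by $r_0=0$ and, for $1\le k\le q$, $r_k=q-(k-1)/2$ for $k$ odd and $r_k=k/2$ for $k$ even. With this $(r_0,\ldots,r_q)$, $\operatorname{MEA}_{n,\omega}$ is defined as the concatenation $\operatorname{ord}_\omega(B_{r_0})\,\Vert\cdots\Vert\,\operatorname{ord}_\omega(B_{r_q})$. A traversal of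 $[n]$ is globally coherent if it visits every shell as one contiguous block, the resulting order of the shells satisfies the maximal-radial-contrast rule (in particular the central block comes first), and there is a single $\omega\in\{+,-\}$ such that every two-element shell $B_r$ is listed in the order $\operatorname{ord}_\omega(B_r)$. *)

(* Defs.v *)
From mathcomp Require Import all_boot all_order all_algebra.
From mathcomp Require Import finmap.

Set Implicit Arguments.
Unset Strict Implicit.
Unset Printing Implicit Defensive.

Local Open Scope fset_scope.
Local Open Scope nat_scope.

(* [n] is {1, ..., n} inside nat; the subtraction
   center_l n - r never truncates in range, as qmax n < center_l n for n >= 1. *)

Definition center_l (n : nat) : nat := (n + 1)./2.

(* uphalf m is the ceiling of m / 2 *)
Definition center_r (n : nat) : nat := uphalf (n + 1).

Definition qmax (n : nat) : nat := (n - 1)./2.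

Definition shell (n r : nat) : {fset nat} :=
  [fset (center_l n - r); (center_r n + r)].

Definition traversal (n : nat) (s : seq nat) : Prop := perm_eq s (iota 1 n).

Inductive orientation : Type := Plus | Minus.

(* undup acts only when the two entries coincide, i.e. n odd and r = 0 *)
Definition ord_shell (n : nat) (w : orientation) (r : nat) : seq nat :=
  match w with
  | Plus => undup [:: center_l n - r; center_r n + r]
  | Minus => undup [:: center_r n + r; center_l n - r]
  end.

Definition shell_traversal (n : nat) (rs : seq nat) : Prop :=
  perm_eq rs (iota 0 (qmax n).+1).

Definition in_argmax (A : pred nat) (f : nat -> nat) (x : nat) : Prop :=
  A x /\ forall y : nat, A y -> f y <= f x.

(* `|r - r'|%N is the absolute difference, not truncated subtraction *)
Definition max_radial_contrast (n : nat) (rs : seq nat) : Prop :=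
  nth 0 rs 0 = 0 /\
  forall k : nat, 1 <= k <= qmax n ->
    in_argmax [pred r | (r <= qmax n) && (r \notin take k rs)]
              (fun r => `|r - nth 0 rs (k - 1)|%N)
              (nth 0 rs k).

(* k-th term of the unique shell traversal satisfying max_radial_contrast *)
Definition mea_radius (n k : nat) : nat :=
  if odd k then qmax n - (k - 1)./2 else k./2.

Definition MEA (n : nat) (w : orientation) : seq nat :=
  flatten [seq ord_shell n w (mea_radius n k) | k <- iota 0 (qmax n).+1].

Definition lists_shell (n r : nat) (blk : seq nat) : Prop :=
  uniq blk /\ blk =i shell n r.

(* s is cut into consecutive blocks, the k-th block listing the k-th shell of
   rs in an arbitrary internal order; for a shell traversal rs this says that s
   visits every shell as one contiguous block, with resulting shell order rs *)
Definition visits_blocks (n : nat) (rs s : seq nat) : Prop :=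
  exists bs : seq (seq nat),
    [/\ s = flatten bs, size bs = size rs &
        forall k : nat, k < size rs ->
          lists_shell n (nth 0 rs k) (nth [::] bs k)].

(* the filter below is the list of the entries of B_r in the order of s *)
Definition globally_coherent (n : nat) (s : seq nat) : Prop :=
  [/\ traversal n s,
      exists rs : seq nat,
        [/\ shell_traversal n rs, visits_blocks n rs s &
            max_radial_contrast n rs] &
      exists w : orientation, forall r : nat,
        r <= qmax n -> #|` shell n r| = 2 ->
        [seq i <- s | i \in shell n r] = ord_shell n w r].

(* Main.v *)
Require Import Defs.
From mathcomp Require Import all_boot all_order all_algebra.
From mathcomp Require Import finmap.
From mathcomp Require Import zify.

Set Implicit Arguments.
Unset Strict Implicit.
Unset Printing Implicit Defensive.

Local Open Scope nat_scope.

(** Coherence leaves a single binary choice.  Writing q for [qmax n], the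
    maximal-radial-contrast rule forces the order of the shells: by induction
    the k shells already visited are the innermost [uphalf k] and the outermost
    [k./2] ones ([mem_mea_radius]), so the unvisited radii form an interval, and
    the last visited radius lies on one side of it, just below or just above.
    The distance to that radius is then strictly monotone on the interval, so
    its maximum is attained only at the opposite end ([mea_radius_argmax]).
    Hence the shell order is that of [mea_radius] ([contrast_mea_radii]), and
    only the order within each two-element block is still open; the common
    orientation fixes it, because in a duplicate-free sequence cut into
    consecutive blocks, the entries of one block, in the order of the whole
    sequence, are the block itself ([filter_block]).

    Conversely, MEA lists each element of {1, ..., n} once, because the shells
    of radius at most m fill the interval from [center_l n - m] to
    [center_r n + m] ([perm_flatten_shells]).  The mirror i |-> n + 1 - i swaps
    the two ends of every shell, so it exchanges the two orientations; the
    outermost shell {1, n} tells them apart when n >= 2. *)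

(** * Blocks of a duplicate-free sequence *)

Lemma filter_block (T : eqType) (bs : seq (seq T)) (k : nat) :
  uniq (flatten bs) -> k < size bs ->
  [seq i <- flatten bs | i \in nth [::] bs k] = nth [::] bs k.
Proof.
move=> + lt_k; set B := nth _ _ _.
rewrite -(cat_take_drop k bs) (drop_nth [::] lt_k) flatten_cat /= -/B.
move: (flatten (take _ _)) (flatten (drop _ _)) => A C.
rewrite uniq_catCA cat_uniq => /and3P[_ /hasPn disj _].
have nil D : {subset D <= A ++ C} -> [seq i <- D | i \in B] = [::].
  move=> sub; apply/eqP; rewrite -size_eq0 size_filter eqn0Ngt -has_count.
  by apply/hasPn => x /sub/disj.
have nilA := nil A (mem_subseq (prefix_subseq A C)).
have nilC := nil C (mem_subseq (suffix_subseq A C)).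
rewrite !filter_cat nilA nilC cats0.
by apply/all_filterP/allP.
Qed.

(** * Geometry of the shells *)

Lemma center_l_qmax n : 0 < n -> center_l n = (qmax n).+1.
Proof. by rewrite /center_l /qmax; lia. Qed.

Lemma center_r_qmax n : 0 < n -> center_r n + qmax n = n.
Proof. by rewrite /center_r /qmax; lia. Qed.

Lemma center_sum n : center_l n + center_r n = n + 1.
Proof. by rewrite /center_l /center_r; lia. Qed.

Lemma center_l_le_r n : center_l n <= center_r n <= (center_l n).+1.
Proof. by rewrite /center_r /center_l; lia. Qed.

Lemma ord_shell_neq n w r : center_l n - r != center_r n + r ->
  ord_shell n w r = if w is Plus then [:: center_l n - r; center_r n + r]
                    else [:: center_r n + r; center_l n - r].
Proof.
by case: w => neq; rewrite /= inE ?(negbTE neq) // eq_sym (negbTE neq).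
Qed.

Lemma lists_ord_shell n w r : lists_shell n r (ord_shell n w r).
Proof.
split; first by case: w; apply: undup_uniq.
by move=> i; case: w; rewrite /ord_shell mem_undup !inE // orbC.
Qed.

Lemma size_ord_shell n w r : size (ord_shell n w r) = #|` shell n r|.
Proof.
rewrite /shell cardfs2.
by case: w; rewrite /= inE; [|rewrite eq_sym]; case: eqP.
Qed.

Lemma perm_ord_shell n w r blk :
  lists_shell n r blk -> perm_eq blk (ord_shell n w r).
Proof.
case=> uniq_blk mem_blk; have [uniq_ord mem_ord] := lists_ord_shell n w r.
by apply: uniq_perm => // i; rewrite mem_blk mem_ord.
Qed.

(** The shells of radius at most m fill an interval: each new shell adds one
    point at either end. *)
Lemma perm_flatten_shells n w m : m < center_l n ->
  perm_eq (flatten [seq ord_shell n w r | r <- iota 0 m.+1])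
          (iota (center_l n - m) (center_r n + m - (center_l n - m)).+1).
Proof.
have le_lr := center_l_le_r n.
elim: m => [|m IHm] lt_m.
  rewrite /= cats0 perm_sym subn0 addn0; apply: perm_ord_shell.
  split=> [|i]; first exact: (iota_uniq _ _.+1).
  by rewrite -[_ :: _]/(iota _ _.+1) mem_iota /shell !inE subn0 addn0; lia.
rewrite -addn1 iotaD map_cat flatten_cat add0n.
rewrite [flatten (map _ (iota _ 1))]/= cats0.
rewrite (permPl (perm_cat (IHm _) (perm_refl _))); last by lia.
rewrite ord_shell_neq; last by lia.
apply: uniq_perm.
- rewrite cat_uniq iota_uniq.
  by case: (w); rewrite /= ?inE !mem_iota; lia.
- exact: iota_uniq.
- move=> i; rewrite mem_cat !mem_iota.
  by case: (w); rewrite !inE; lia.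
Qed.

(** * Maximal radial contrast forces the shell order *)

Definition mea_radii (n : nat) : seq nat := mkseq (mea_radius n) (qmax n).+1.

(** The alternation keeps the unvisited radii in one interval, from [uphalf k]
    to [qmax n - k./2]. *)
Lemma mem_mea_radius n k r : k <= (qmax n).+1 ->
  (r \in mkseq (mea_radius n) k) =
    (r <= qmax n) && ((r < uphalf k) || (qmax n < r + k./2)).
Proof.
elim: k => [|k IHk] le_k.
  by rewrite /= in_nil; lia.
rewrite mkseqS mem_rcons in_cons IHk; last by lia.
by rewrite /mea_radius; case: ifP; lia.
Qed.

(** The previous radius is adjacent to the interval of unvisited radii, so the
    distance to it is strictly monotone there and the farthest unvisited radius
    is unique: the top of the interval for k odd, the bottom for k even. *)
Lemma mea_radius_argmax n k r : 1 <= k <= qmax n ->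
  in_argmax [pred r | (r <= qmax n) && (r \notin mkseq (mea_radius n) k)]
            (fun r => `|r - mea_radius n (k - 1)|%N) r
  <-> r = mea_radius n k.
Proof.
move=> k_range; rewrite /in_argmax /=.
split=> [[]|->].
  rewrite mem_mea_radius ?{1}/mea_radius; last by lia.
  move=> r_free /(_ (mea_radius n k)).
  rewrite mem_mea_radius; last by lia.
  move: r_free; rewrite /mea_radius; case: ifP; case: ifP; lia.
split=> [|y].
  by rewrite mem_mea_radius /mea_radius; [case: ifP; lia | lia].
rewrite mem_mea_radius; last by lia.
by rewrite /mea_radius; case: ifP; case: ifP; lia.
Qed.

Lemma contrast_mea_radii n rs : size rs = (qmax n).+1 ->
  max_radial_contrast n rs <-> rs = mea_radii n.
Proof.
move=> sz_rs; split=> [[rs0 contrast]|->].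
  have prefix k : k <= (qmax n).+1 -> take k rs = mkseq (mea_radius n) k.
    elim: k => [|k IHk] le_k; first by rewrite take0.
    rewrite (take_nth 0) ?sz_rs // mkseqS IHk; last by lia.
    congr rcons; case: k => [|k] in IHk le_k *; first by rewrite rs0.
    apply/mea_radius_argmax; first by lia.
    have /contrast : 1 <= k.+1 <= qmax n by lia.
    rewrite IHk; last by lia.
    suff -> : nth 0 rs (k.+1 - 1) = mea_radius n (k.+1 - 1) by [].
    rewrite subSS subn0 -(nth_take 0 (ltnSn k)) IHk; last by lia.
    by rewrite nth_mkseq.
  by rewrite /mea_radii -prefix // -sz_rs take_size.
split=> [|k k_range]; first by rewrite nth_mkseq.
rewrite !nth_mkseq; try lia.
have -> : take k (mea_radii n) = mkseq (mea_radius n) k.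
  by rewrite -map_take take_iota (minn_idPl _) //; lia.
exact/mea_radius_argmax.
Qed.

(** For k = q + 1 the two groups of visited radii in [mem_mea_radius] cover
    {0, ..., q}, and the length q + 1 leaves no room for repetitions. *)
Lemma shell_traversal_mea_radii n : shell_traversal n (mea_radii n).
Proof.
have uniq_r := iota_uniq 0 (qmax n).+1.
have sub : {subset iota 0 (qmax n).+1 <= mea_radii n}.
  by move=> r; rewrite mem_iota mem_mea_radius //; lia.
have le_sz : size (mea_radii n) <= size (iota 0 (qmax n).+1).
  by rewrite size_mkseq size_iota.
have [_ eq_r] := uniq_min_size uniq_r sub le_sz.
have uniq_mea := leq_size_uniq uniq_r sub le_sz.
by apply: uniq_perm => // r; rewrite eq_r.
Qed.

(** * Globally coherent traversals *)

Lemma MEA_flatten n w :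
  MEA n w = flatten [seq ord_shell n w r | r <- mea_radii n].
Proof. by rewrite /MEA /mea_radii /mkseq -map_comp. Qed.

Lemma traversal_MEA n w : 0 < n -> traversal n (MEA n w).
Proof.
move=> n_gt0; have [eq_l eq_r] := (center_l_qmax n_gt0, center_r_qmax n_gt0).
rewrite /traversal MEA_flatten.
have perm_r := perm_map (ord_shell n w) (shell_traversal_mea_radii n).
rewrite (permPl (perm_flatten perm_r)).
rewrite (permPl (perm_flatten_shells _ _)) ?eq_l // eq_r.
by rewrite subSnn subn1 prednK.
Qed.

(** Each shell is one of the blocks of MEA, so [filter_block] reads it back. *)
Lemma filter_MEA n w r : 0 < n -> r <= qmax n ->
  [seq i <- MEA n w | i \in shell n r] = ord_shell n w r.
Proof.
move=> n_gt0 le_r; set bs := [seq ord_shell n w r | r <- mea_radii n].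
have r_in : r \in mea_radii n.
  by rewrite (perm_mem (shell_traversal_mea_radii n)) mem_iota.
have lt_k : index r (mea_radii n) < size bs by rewrite size_map index_mem.
have nth_k : nth [::] bs (index r (mea_radii n)) = ord_shell n w r.
  by rewrite (nth_map 0) ?index_mem // nth_index.
have uniq_bs : uniq (flatten bs).
  by rewrite -MEA_flatten (perm_uniq (traversal_MEA w n_gt0)) iota_uniq.
rewrite -[RHS]nth_k -filter_block // -MEA_flatten nth_k.
by apply: eq_filter => i; case: (lists_ord_shell n w r) => _ ->.
Qed.

Lemma globally_coherent_MEA n w : 0 < n -> globally_coherent n (MEA n w).
Proof.
move=> n_gt0; split; first exact: traversal_MEA.
- exists (mea_radii n); split; first exact: shell_traversal_mea_radii.
  + exists [seq ord_shell n w r | r <- mea_radii n].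
    rewrite size_map MEA_flatten; split=> // k lt_k.
    by rewrite (nth_map 0) //; apply: lists_ord_shell.
  + by apply/contrast_mea_radii; rewrite ?size_mkseq.
- by exists w => r le_r _; apply: filter_MEA.
Qed.

(** The contrast rule gives the order of the blocks, and [filter_block] turns
    the orientation of a two-element shell into the content of its block. *)
Lemma globally_coherent_eq_MEA n s :
  globally_coherent n s -> exists w, s = MEA n w.
Proof.
case=> trav [rs [perm_rs [bs [def_s sz_bs blocks]] contrast]] [w coherent].
exists w; have sz_rs : size rs = (qmax n).+1.
  by rewrite (perm_size perm_rs) size_iota.
have def_rs : rs = mea_radii n by apply/contrast_mea_radii.
rewrite MEA_flatten def_s -def_rs; congr flatten.
apply: (@eq_from_nth _ [::]) => [|k lt_k]; first by rewrite size_map.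
rewrite sz_bs in lt_k; rewrite (nth_map 0) //.
have le_r : nth 0 rs k <= qmax n.
  by have := mem_nth 0 lt_k; rewrite (perm_mem perm_rs) mem_iota.
have blk := blocks k lt_k.
have [two|not_two] := eqVneq #|` shell n (nth 0 rs k)| 2.
  rewrite -coherent // def_s -[LHS]filter_block ?sz_bs //.
    by apply: eq_filter => i; case: blk => _ ->.
  by rewrite -def_s (perm_uniq trav) iota_uniq.
(* The block of a singleton shell can be listed in one way only *)
apply: perm_small_eq; last exact: perm_ord_shell.
rewrite size_ord_shell; move: not_two; rewrite /shell cardfs2.
by case: (center_l _ - _ == _).
Qed.

(** The outermost shell is {1, n}, whose two orders differ once n >= 2. *)
Lemma MEA_Plus_neq_Minus n : 2 <= n -> MEA n Plus <> MEA n Minus.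
Proof.
move=> n_ge2 eq_MEA; have n_gt0 : 0 < n by lia.
have [eq_l eq_r] := (center_l_qmax n_gt0, center_r_qmax n_gt0).
have := filter_MEA Plus n_gt0 (leqnn (qmax n)).
rewrite eq_MEA filter_MEA // !ord_shell_neq ?eq_l ?eq_r; try lia.
by case; lia.
Qed.

(** The two ends of a shell add up to n + 1, so the mirror swaps them. *)
Lemma mirror_ord_shell n w r : 0 < n -> r <= qmax n ->
  [seq n + 1 - i | i <- ord_shell n w r] =
    ord_shell n (if w is Plus then Minus else Plus) r.
Proof.
move=> n_gt0 le_r; have eq_l := center_l_qmax n_gt0.
have sum := center_sum n; have le_lr := center_l_le_r n.
have [eq|neq] := eqVneq (center_l n - r) (center_r n + r).
  by case: w; rewrite /= !inE eq !eqxx /=; congr [:: _]; lia.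
by rewrite !ord_shell_neq //; case: w => /=; congr [:: _; _]; lia.
Qed.

Lemma mirror_MEA n w : 0 < n ->
  [seq n + 1 - i | i <- MEA n w] = MEA n (if w is Plus then Minus else Plus).
Proof.
move=> n_gt0; rewrite !MEA_flatten map_flatten -map_comp; congr flatten.
apply/eq_in_map => r r_in; apply: mirror_ord_shell => //.
by move: r_in; rewrite (perm_mem (shell_traversal_mea_radii n)) mem_iota.
Qed.

Theorem mainTheorem3 (n : nat) (hn : 2 <= n) :
  [/\ forall s : seq nat,
        globally_coherent n s <-> s = MEA n Plus \/ s = MEA n Minus,
      MEA n Plus <> MEA n Minus,
      MEA n Minus = [seq n + 1 - i | i <- MEA n Plus] &
      MEA n Plus = [seq n + 1 - i | i <- MEA n Minus]].
Proof.
have n_gt0 : 0 < n by lia.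
split; [|exact: MEA_Plus_neq_Minus|by rewrite mirror_MEA..].
move=> s; split=> [/globally_coherent_eq_MEA[[] ->]|[] ->].
- by left.
- by right.
- exact: globally_coherent_MEA.
- exact: globally_coherent_MEA.
Qed.
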